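(* Consider (not necessarily reversible) Markov chains $Y$ and $Z$ with common finite partially ordered state space $\mathcal{X}$, common initial distribution $\hat\pi$ and common stationary distribution $\pi$. Assume that $\hat\pi/\pi$ is nonincreasing. (a) (total variation distance) Suppose that $Y$ dominates $Z$ and that the time-reversal of $Y$ is stochastically monotone. Then $Y$ mixes faster in total variation than does $Z$; that is, $\mathrm{TV}_Y(t)\le \mathrm{TV}_Z(t)$ for every $t$. (b) (separation) Adopt the same hypotheses as in part (a). Then $Y$ mixes faster in separation than does $Z$, that is, $\mathrm{sep}_Y(t)\le\mathrm{sep}_Z(t)$ for every $t$; equivalently, any fastest strong stationary time for $Y$ is stochastically smaller than any strong stationary time for $Z$. (c) ($L^2$-distance) Assume that $Y$ and $Z$ are reversible. Suppose, moreover, that the two-step chain $(Y_{2t})_{t\ge0}$ dominates $(Z_{2t})_{t\ge0}$ and is stochastically monotone. Then $Y$ mixes faster in $L^2$ than does $Z$; that is, for every $t$ the $L^2(\pi)$-distance from stationarity of $Y_t$ is at most that of $Z_t$.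
   Context: Chains are discrete-time ($t=0,1,2,\ldots$) and time-homogeneous; $\pi$ is a probability mass function on $\mathcal{X}$ with $\pi(i)>0$ for all $i$. A function $f$ on $\mathcal{X}$ is nonincreasing if $x\le y$ implies $f(x)\ge f(y)$. A down-set is a set $D\subseteq\mathcal{X}$ such that $y\in D$ and $x\le y$ imply $x\in D$. A process $Y$ dominates a process $Z$ if for every time $t$ and every down-set $D$, $\mathbf{P}(Y_t\in D)\le\mathbf{P}(Z_t\in D)$. A kernel $K$ (or a chain with kernel $K$) is stochastically monotone if $Kf$ is nonnegative and nonincreasing whenever $f$ is, where $(Kf)(i)=\sum_jK(i,j)f(j)$; the two-step chain $(Y_{2t})$ has kernel $K^2$ if $Y$ has kernel $K$. The time-reversal of a kernel $K$ with stationary distribution $\pi$ is $K^*(i,j)=\pi(j)K(j,i)/\pi(i)$; the chain is reversible if $K=K^*$. For a chain $X$: $\mathrm{TV}_X(t)=\max_{A\subseteq\mathcal{X}}|\mathbf{P}(X_t\in A)-\pi(A)|$; $\mathrm{sep}_X(t)=\max_i\left[1-\mathbf{P}(X_t=i)/\pi(i)\right]$; the $L^2(\pi)$-distance from stationarity of $X_t$ is $\left(\sum_i\pi(i)\left[\mathbf{P}(X_t=i)/\pi(i)-1\right]^2\right)^{1/2}$. A strong stationary time for $X$ is a randomized stopping time $T$ (possibly taking the value $\infty$) such that $\mathbf{P}(T=t,X_t=i)=\mathbf{P}(T=t)\pi(i)$ for all finite $t$ and all $i$; it is fastest if it is stochastically minimal among strong stationary times, equivalently $\mathbf{P}(T>t)=\mathrm{sep}_X(t)$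 for every $t$. ''$T$ is stochastically smaller than $T'$'' means $\mathbf{P}(T>t)\le\mathbf{P}(T'>t)$ for every $t$. *)

(* Defs.v *)
From HB Require Import structures.
From mathcomp Require Import all_boot all_order all_algebra.
From mathcomp Require Import all_classical all_reals all_analysis.

Set Implicit Arguments.
Unset Strict Implicit.
Unset Printing Implicit Defensive.

Import Order.TTheory GRing.Theory Num.Theory.

Local Open Scope classical_set_scope.
Local Open Scope ring_scope.

Section Kernels.
Context {R : realType} {dX : Order.disp_t} {X : finPOrderType dX}.
Implicit Types (f mu pi : X -> R) (K : X -> X -> R) (D : {set X}).

Definition is_pmf mu : Prop :=
  (forall i, 0 <= mu i) /\ \sum_i mu i = 1.

Definition is_kernel K : Prop := forall i, is_pmf (K i).

Definition stationary pi K : Prop :=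
  forall j, \sum_i pi i * K i j = pi j.

Definition nonincreasing f : Prop :=
  forall x y, (x <= y)%O -> f y <= f x.

Definition down_set D : Prop :=
  forall x y, y \in D -> (x <= y)%O -> x \in D.

Definition kernel_act K f : X -> R := fun i => \sum_j K i j * f j.

Definition stochastically_monotone K : Prop :=
  forall f, (forall i, 0 <= f i) -> nonincreasing f ->
    (forall i, 0 <= kernel_act K f i) /\ nonincreasing (kernel_act K f).

Definition time_reversal pi K : X -> X -> R :=
  fun i j => pi j * K j i / pi i.

Definition reversible pi K : Prop :=
  forall i j, K i j = time_reversal pi K i j.

Definition kernel_sq K : X -> X -> R := fun i j => \sum_k K i k * K k j.

End Kernels.

Section Processes.
Context {R : realType} {dX : Order.disp_t} {X : finPOrderType dX}.
Context {d : measure_display} {Omega : measurableType d}.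
Variable P : probability Omega R.
Implicit Types (Y : nat -> Omega -> X) (pi mu : X -> R) (K : X -> X -> R).

Definition prob (E : set Omega) : R := fine (P E).

Definition history Y (x : nat -> X) (t : nat) : set Omega :=
  [set w | forall s, (s <= t)%N -> Y s w = x s].

(* The Markov property
     P(Y_{t+1} = j | Y_0 = x_0, ..., Y_t = x_t) = K(x_t, j),
   multiplied out so that null histories impose no condition. *)
Definition markov_chain Y mu K : Prop :=
  [/\ forall t i, measurable [set w | Y t w = i],
      forall i, prob [set w | Y 0%N w = i] = mu i &
      forall t (x : nat -> X) j,
        prob (history Y x t `&` [set w | Y t.+1 w = j]) =
        prob (history Y x t) * K (x t) j].

Definition two_step Y : nat -> Omega -> X := fun t => Y (2 * t)%N.

Definition law Y (t : nat) (i : X) : R := prob [set w | Y t w = i].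

Definition TV pi Y (t : nat) : R :=
  \big[Num.max/0]_(A : {set X})
    `|prob [set w | Y t w \in A] - \sum_(i in A) pi i|.

(* The default value 0 is harmless: as the law of Y_t and pi both sum to 1,
   some term of the maximum is nonnegative. *)
Definition sep pi Y (t : nat) : R :=
  \big[Num.max/0]_(i : X) (1 - law Y t i / pi i).

Definition L2_dist pi Y (t : nat) : R :=
  Num.sqrt (\sum_i pi i * (law Y t i / pi i - 1) ^+ 2).

(* Random times take values in option nat, None being the value infinity. *)
Definition tail (T : Omega -> option nat) (t : nat) : R :=
  prob [set w | forall s, (s <= t)%N -> T w <> Some s].

(* Given (Y_0, ..., Y_t), the event {T = t} is conditionally independent of
   the future of Y; the defining identities are multiplied out. *)
Definition randomized_stopping_time Y (T : Omega -> option nat) : Prop :=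
  (forall t, measurable [set w | T w = Some t]) /\
  (forall t n (x : nat -> X), (t <= n)%N ->
     prob ([set w | T w = Some t] `&` history Y x n) * prob (history Y x t) =
     prob ([set w | T w = Some t] `&` history Y x t) * prob (history Y x n)).

Definition strong_stationary_time pi Y (T : Omega -> option nat) : Prop :=
  randomized_stopping_time Y T /\
  (forall t i, prob ([set w | T w = Some t] `&` [set w | Y t w = i]) =
               prob [set w | T w = Some t] * pi i).

End Processes.

Definition dominates {R : realType} {dX : Order.disp_t} {X : finPOrderType dX}
    {d1 : measure_display} {O1 : measurableType d1} (P1 : probability O1 R)
    (Y : nat -> O1 -> X)
    {d2 : measure_display} {O2 : measurableType d2} (P2 : probability O2 R)
    (Z : nat -> O2 -> X) : Prop :=
  forall t (D : {set X}), down_set D ->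
    prob P1 [set w | Y t w \in D] <= prob P2 [set w | Z t w \in D].

Definition stochastically_smaller {R : realType}
    {d1 : measure_display} {O1 : measurableType d1} (P1 : probability O1 R)
    (T1 : O1 -> option nat)
    {d2 : measure_display} {O2 : measurableType d2} (P2 : probability O2 R)
    (T2 : O2 -> option nat) : Prop :=
  forall t, tail P1 T1 t <= tail P2 T2 t.

(* Randomization may require enlarging the probability space, so minimality is
   over the strong stationary times of all realizations of the chain with
   initial distribution mu and kernel K. *)
Definition fastest_sst {R : realType} {dX : Order.disp_t}
    {X : finPOrderType dX} {d : measure_display} {Omega : measurableType d}
    (P : probability Omega R) (mu : X -> R) (K : X -> X -> R) (pi : X -> R)
    (Y : nat -> Omega -> X) (T : Omega -> option nat) : Prop :=
  strong_stationary_time P pi Y T /\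
  forall (d' : measure_display) (Omega' : measurableType d')
    (P' : probability Omega' R) (Y' : nat -> Omega' -> X)
    (T' : Omega' -> option nat),
    markov_chain P' Y' mu K -> strong_stationary_time P' pi Y' T' ->
    stochastically_smaller P T P' T'.

(* Main.v *)
Require Import Defs.
From HB Require Import structures.
From mathcomp Require Import all_boot all_order all_algebra.
From mathcomp Require Import all_classical all_reals all_analysis.
From mathcomp Require Import ring lra zify.

(** Write rho_t = law(Y_t) / pi.  Since rho_(t+1) is the image of rho_t under
    the time-reversal of K ([ratio_step]), monotonicity of the reversal keeps
    every rho_t nonincreasing once rho_0 is ([law_ratio_nonincreasing]).  Hence
    all level sets {rho_t > c} are down-sets, which are exactly the events on
    which domination compares Y_t with Z_t.

    Total variation: the distance for Y is attained at the level set
    {rho_t > 1}, and there Z deviates from pi at least as much as Y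
    ([deviation_le]).  Separation: 1 - sep is the minimum of rho_t, or 1 if
    that is smaller; on the complement of a level set Z has at most the mass of
    Y, so the density of Z cannot stay above the minimum of rho_t
    ([ratio_lower_bound]).

    Strong stationary times: any such time T for Z has
    P(T > t) >= sep_Z(t) ([sep_le_tail]).  Conversely it is enough to exhibit,
    for each single t, one realization of Y with a strong stationary time whose
    tail at t is exactly sep_Y(t); minimality of a fastest time then gives the
    upper bound.  A time with values in {t, oo} does this: stop at t with
    probability (1 - sep_Y(t)) pi(i) / P(Y_t = i) when Y_t = i, using an
    independent uniform variable ([acceptance_time_sst],
    [tail_acceptance_time]).

    L2: for a reversible chain K is self-adjoint, so that
    <rho_t, rho_t> = <rho_0, rho_2t> = E[rho_0(Y_2t)] ([L2_dist_law]).  The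
    squared distance is thus, up to the constant 1, the expectation of the
    nonincreasing function rho_0 under the two-step chain, and domination
    orders such expectations ([stochastic_order_nonincreasing]). *)

Set Implicit Arguments.
Unset Strict Implicit.
Unset Printing Implicit Defensive.

Import Order.TTheory GRing.Theory Num.Theory.

Local Open Scope ring_scope.

(** * Nonincreasing functions and time-reversal *)

Section PartialOrder.
Context {R : realType} {dX : Order.disp_t} {X : finPOrderType dX}.
Implicit Types (f g mu nu pi : X -> R) (K : X -> X -> R).

Lemma level_down_set f c : nonincreasing f -> down_set [set x | c < f x].
Proof.
by move=> nf x y; rewrite !inE => cfy /nf; exact: lt_le_trans.
Qed.

(** Layer-cake argument: a nonnegative nonincreasing function is a nonnegative
    combination of indicators of down-sets.  The lowest layer is peeled off at
    each step, which shrinks the support. *)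
Lemma stochastic_order_nonincreasing f mu nu :
  (forall D, down_set D -> \sum_(i in D) mu i <= \sum_(i in D) nu i) ->
  (forall i, 0 <= f i) -> nonincreasing f ->
  \sum_i f i * mu i <= \sum_i f i * nu i.
Proof.
move=> le_mu_nu.
have [n] := ubnP #|[set x | 0 < f x]%SET|.
elim: n f => // n IHn f; rewrite ltnS => leD f0 nf.
set D := [set x | 0 < f x]%SET in leD.
have dD : down_set D by exact: level_down_set.
have [D0 | [x0 x0D]] := set_0Vmem D.
  suff f_eq0 i : f i = 0.
    by rewrite !big1// => i _; rewrite f_eq0 mul0r.
  apply/eqP; rewrite eq_le f0 andbT leNgt; apply/negP => fi.
  by have : i \in D by [rewrite inE]; rewrite D0 inE.
pose m := [arg min_(x < x0 in D) f x]%O.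
have [mD m_min] : m \in D /\ (forall x, x \in D -> f m <= f x).
  by rewrite /m; case: arg_minP.
pose f' x := if x \in D then f x - f m else 0.
have fE x : f x = f' x + f m * (x \in D)%:R.
  rewrite /f'; case: ifPn => xD; first by rewrite mulr1 subrK.
  apply/eqP; rewrite mulr0 addr0 eq_le f0 andbT.
  by rewrite leNgt; move: xD; rewrite inE.
have sumE nu' :
    \sum_i f i * nu' i = \sum_i f' i * nu' i + f m * \sum_(i in D) nu' i.
  rewrite [in X in _ + X]big_mkcond mulr_sumr -big_split; apply: eq_bigr => i _.
  by rewrite {1}fE mulrDl -mulrA mulrb; case: ifP; rewrite ?mul1r// mul0r.
rewrite !sumE lerD//; last by rewrite ler_wpM2l// le_mu_nu.
apply: IHn => [|i|x y xy].
- apply: leq_trans leD; apply: proper_card; apply/properP; split.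
    by apply/fintype.subsetP => i; rewrite inE /f'; case: ifP => //; rewrite ltxx.
  by exists m => //; rewrite inE /f' mD subrr ltxx.
- by rewrite /f'; case: ifPn => // /m_min; rewrite subr_ge0.
- rewrite /f'; case: ifPn => yD; last first.
    by case: ifPn => // /m_min; rewrite subr_ge0.
  by rewrite (dD _ _ yD xy) lerD2r nf.
Qed.

(** Densities with respect to pi evolve by the time-reversal acting on
    functions; this is where the hypothesis on the reversal enters. *)
Lemma ratio_step pi K mu : (forall i, 0 < pi i) ->
  (fun j => (\sum_i mu i * K i j) / pi j) =
  kernel_act (time_reversal pi K) (fun i => mu i / pi i).
Proof.
move=> pi0; apply/funext => j; rewrite /kernel_act /time_reversal mulr_suml.
apply: eq_bigr => i _.
by field; rewrite !lt0r_neq0.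
Qed.

End PartialOrder.

(** * Probabilities split along the values of a finite random variable *)

Section Laws.
Context {R : realType} {d : measure_display} {Omega : measurableType d}.
Variable P : probability Omega R.
Local Open Scope classical_set_scope.
Implicit Types A B E : set Omega.

Lemma probE A : measurable A -> P A = (prob P A)%:E.
Proof. by move=> mA; rewrite fineK// fin_num_measure. Qed.

Lemma prob_ge0 A : 0 <= prob P A.
Proof. by rewrite fine_ge0. Qed.

Lemma prob_set0 : prob P set0 = 0.
Proof. by rewrite /prob measure0. Qed.

Lemma prob_setT : prob P [set: Omega] = 1.
Proof. by rewrite /prob probability_setT. Qed.

Lemma prob_setC A : measurable A -> prob P (~` A) = 1 - prob P A.
Proof.
by move=> mA; rewrite {1}/prob probability_setC// probE.
Qed.

Lemma prob_le A B : measurable A -> measurable B -> A `<=` B ->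
  prob P A <= prob P B.
Proof.
move=> mA mB AB; rewrite -lee_fin -!probE//.
by apply: le_measure; rewrite ?inE.
Qed.

Lemma prob_fiber_sum (F : finType) (f : Omega -> F) E :
  measurable E -> (forall a, measurable [set w | f w = a]) ->
  prob P E = \sum_a prob P (E `&` [set w | f w = a]).
Proof.
move=> mE mf; apply: EFin_inj; rewrite -probE// -sumEFin.
have {1}-> : E =
    \bigcup_(a in [set` index_enum F]) (E `&` [set w | f w = a]).
  apply/seteqP; split => [w Ew|w [a _ []]//].
  by exists (f w) => //=; rewrite mem_index_enum.
rewrite measure_fin_bigcup//; first last.
- by move=> a _; exact: measurableI.
- apply/trivIsetP => a b _ _ /eqP ab; rewrite -subset0 => w [[_ /= fa] [_ /= fb]].
  by apply: ab; rewrite -fa -fb.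
rewrite -fsbig_seq ?index_enum_uniq//; apply: eq_bigr => a _.
by apply: probE; exact: measurableI.
Qed.


Lemma prob_fiber_mem (F : finType) (f : Omega -> F) (A : {set F}) E :
  measurable E -> (forall a, measurable [set w | f w = a]) ->
  prob P (E `&` [set w | f w \in A]) =
  \sum_(a in A) prob P (E `&` [set w | f w = a]).
Proof.
move=> mE mf.
have mA : measurable [set w | f w \in A].
  rewrite (_ : [set _ | _] = \bigcup_(a in [set` A]) [set w | f w = a]).
    by apply: fin_bigcup_measurable => //; exact: finite_finset.
  by apply/seteqP; split => [w ?|w [a /= aA ->]]//; exists (f w).
rewrite (prob_fiber_sum (measurableI _ _ mE mA) mf) [RHS]big_mkcond.
apply: eq_bigr => a _; case: ifPn => aA.
  congr prob; apply/seteqP; split => [w [[]]//|w [Ew /= fw]].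
  by split => //; split => //=; rewrite fw.
rewrite -prob_set0; congr prob; rewrite -subset0 => w [[_ /= fA] /= fw].
by move: aA; rewrite -fw fA.
Qed.

Context {dX : Order.disp_t} {X : finPOrderType dX}.
Variable Y : nat -> Omega -> X.
Hypothesis mY : forall t i, measurable [set w | Y t w = i].

Lemma measurable_history x t : measurable (history Y x t).
Proof.
rewrite (_ : history Y x t =
    \bigcap_(s in [set s | (s <= t)%N]) [set w | Y s w = x s]).
  by apply: bigcap_measurableType => k _; exact: mY.
by apply/seteqP; split => w /=.
Qed.

(** The auxiliary event E carries extra information, such as the value of a
    stopping time, past which the Markov property still holds; E = setT gives
    the usual evolution of the law.  The proof sums over all histories. *)
Lemma chapman_kolmogorov (K : X -> X -> R) E t j : measurable E ->
  (forall x : nat -> X, prob P (E `&` history Y x t `&` [set w | Y t.+1 w = j]) =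
             prob P (E `&` history Y x t) * K (x t) j) ->
  prob P (E `&` [set w | Y t.+1 w = j]) =
  \sum_i prob P (E `&` [set w | Y t w = i]) * K i j.
Proof.
move=> mE markovE.
pose path w := [ffun s : 'I_t.+1 => Y s w].
pose ext (a : {ffun 'I_t.+1 -> X}) (s : nat) := a (inord s).
have pathE a : [set w | path w = a] = history Y (ext a) t.
  apply/seteqP; split => [w /= <- s st|w /= h].
    by rewrite /ext ffunE inordK.
  by apply/ffunP => s; rewrite ffunE h ?/ext ?inord_val// -ltnS.
have mpath a : measurable [set w | path w = a].
  by rewrite pathE; exact: measurable_history.
have history_sum E' : measurable E' ->
    prob P E' = \sum_a prob P (E' `&` history Y (ext a) t).
  move=> mE'; rewrite (prob_fiber_sum mE' mpath); apply: eq_bigr => a _.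
  by congr (prob _ (_ `&` _)); exact: pathE.
rewrite (history_sum _ (measurableI _ _ mE (mY t.+1 j))).
rewrite (partition_big (fun a => ext a t) predT)//=; apply: eq_bigr => i _.
rewrite (history_sum _ (measurableI _ _ mE (mY t i))) mulr_suml.
rewrite big_mkcond; apply: eq_bigr => a _.
case: eqVneq => [<-|ati].
  rewrite setIAC markovE; congr (prob _ _ * _).
  rewrite setIAC; apply/esym/setIidPl => w [_ hw].
  exact: hw.
rewrite (_ : _ `&` _ = set0) ?prob_set0 ?mul0r//.
rewrite -subset0 => w [[_ /= Yi]] h.
by move/eqP: ati; apply; rewrite -Yi h.
Qed.

End Laws.

(** * Laws of Markov chains *)

Section MarkovChains.
Context {R : realType} {dX : Order.disp_t} {X : finPOrderType dX}.
Context {d : measure_display} {Omega : measurableType d}.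
Variable P : probability Omega R.
Variables (Y : nat -> Omega -> X) (mu : X -> R) (K : X -> X -> R).
Hypothesis hY : markov_chain P Y mu K.
Local Open Scope classical_set_scope.

Lemma markov_measurable t i : measurable [set w | Y t w = i].
Proof. by case: hY. Qed.
Let mY := markov_measurable.

Lemma law_step t j : law P Y t.+1 j = \sum_i law P Y t i * K i j.
Proof.
case: hY => _ _ mk.
rewrite /law -[X in prob P X]setTI (chapman_kolmogorov (K := K) mY)//.
  by apply: eq_bigr => i _; rewrite setTI.
by move=> x; rewrite setTI mk.
Qed.

Lemma prob_mem_law t (A : {set X}) :
  prob P [set w | Y t w \in A] = \sum_(i in A) law P Y t i.
Proof.
rewrite -[X in prob P X]setTI prob_fiber_mem//.
by apply: eq_bigr => i _; rewrite setTI.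
Qed.

Lemma law_ge0 t i : 0 <= law P Y t i.
Proof. exact: prob_ge0. Qed.

Lemma sum_law t : \sum_i law P Y t i = 1.
Proof.
have := prob_fiber_sum P measurableT (mY t); rewrite prob_setT => ->.
by apply: eq_bigr => i _; rewrite setTI.
Qed.

Lemma law0 i : law P Y 0 i = mu i.
Proof. by case: hY => _ init _; exact: init. Qed.

Lemma law_ratio_nonincreasing pi t : (forall i, 0 < pi i) ->
  stochastically_monotone (time_reversal pi K) ->
  nonincreasing (fun i => mu i / pi i) ->
  nonincreasing (fun i => law P Y t i / pi i).
Proof.
move=> pi0 mono rho0; elim: t => [|t IHt].
  by move=> x y /rho0; rewrite !law0.
rewrite (_ : (fun i => _) = kernel_act (time_reversal pi K) (fun i => law P Y t i / pi i)).
  by apply: (mono _ _ IHt).2 => i; rewrite divr_ge0 ?law_ge0// ltW.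
rewrite -ratio_step//; apply/funext => i.
by rewrite law_step.
Qed.

(** Self-adjointness of a reversible kernel in L2(pi), applied to densities:
    one time unit moves from one factor of the inner product to the other. *)
Lemma law_inner_reversible pi s r : (forall i, 0 < pi i) -> reversible pi K ->
  \sum_i law P Y s.+1 i * law P Y r i / pi i =
  \sum_i law P Y s i * law P Y r.+1 i / pi i.
Proof.
move=> pi0 rev.
transitivity (\sum_i \sum_j law P Y s i * law P Y r j * K j i / pi i).
  rewrite exchange_big; apply: eq_bigr => j _.
  rewrite law_step !mulr_suml; apply: eq_bigr => i _.
  rewrite rev /time_reversal; field.
  by rewrite !lt0r_neq0.
apply: eq_bigr => i _; rewrite [law P Y r.+1 i]law_step mulr_sumr mulr_suml.
by apply: eq_bigr => j _; rewrite mulrA.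
Qed.

(** Moving all t steps onto one factor turns the squared norm of the density
    at time t into a linear functional of the law at time 2t. *)
Lemma L2_dist_law pi t : (forall i, 0 < pi i) -> \sum_i pi i = 1 ->
  reversible pi K ->
  L2_dist P pi Y t =
  Num.sqrt (\sum_i mu i / pi i * law P Y (2 * t) i - 1).
Proof.
move=> pi0 pi1 rev; rewrite /L2_dist; congr Num.sqrt.
transitivity (\sum_i law P Y t i * law P Y t i / pi i - 1).
  transitivity (\sum_i (law P Y t i * law P Y t i / pi i
                         - 2 * law P Y t i + pi i)).
    by apply: eq_bigr => i _; field; rewrite lt0r_neq0.
  by rewrite big_split sumrB /= -mulr_sumr sum_law pi1; ring.
congr (_ - 1).
suff shift s r : \sum_i law P Y s i * law P Y r i / pi i =
    \sum_i mu i / pi i * law P Y (s + r) i.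
  by rewrite shift mul2n addnn.
elim: s r => [|s IHs] r.
  by apply: eq_bigr => i _; rewrite law0 mulrAC.
by rewrite law_inner_reversible// IHs addnS.
Qed.

End MarkovChains.

Lemma law_unique {R : realType} {dX : Order.disp_t} {X : finPOrderType dX}
    {d1 d2 : measure_display} {O1 : measurableType d1} {O2 : measurableType d2}
    (P1 : probability O1 R) (P2 : probability O2 R)
    (Y1 : nat -> O1 -> X) (Y2 : nat -> O2 -> X) (mu : X -> R) (K : X -> X -> R)
    t : markov_chain P1 Y1 mu K -> markov_chain P2 Y2 mu K ->
  law P1 Y1 t = law P2 Y2 t.
Proof.
move=> hY1 hY2; elim: t => [|t IHt]; apply/funext => i.
  by rewrite (law0 hY1) (law0 hY2).
by rewrite (law_step hY1) (law_step hY2) IHt.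
Qed.

(** * Comparing total variation and separation *)

Section Comparison.
Context {R : realType} {dX : Order.disp_t} {X : finPOrderType dX}.
Variables pi mu nu : X -> R.
Hypothesis pi_gt0 : forall i, 0 < pi i.
Hypothesis mass : \sum_i mu i = \sum_i nu i.
Hypothesis ratio_mono : nonincreasing (fun i => mu i / pi i).
Hypothesis mu_nu :
  forall D, down_set D -> \sum_(i in D) mu i <= \sum_(i in D) nu i.

Lemma sum_setC (A : {set X}) (g : X -> R) :
  \sum_i g i = \sum_(i in A) g i + \sum_(i in ~: A) g i.
Proof.
by rewrite (bigID [in A]) /=; congr (_ + _); apply: eq_bigl => i; rewrite inE.
Qed.

(** The deviation mu(A) - pi(A) is largest when A collects exactly the points
    of density above 1; that set is a down-set, so there nu deviates at least
    as much.  A deficit on A is an excess on its complement. *)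
Lemma deviation_le (A : {set X}) : \sum_i mu i = \sum_i pi i ->
  exists D : {set X}, `|\sum_(i in A) mu i - \sum_(i in A) pi i| <=
            \sum_(i in D) nu i - \sum_(i in D) pi i.
Proof.
move=> mass_pi; pose D := [set i | 1 < mu i / pi i]%SET.
exists D.
have mem_D i : (i \in D) = (0 < mu i - pi i).
  by rewrite inE ltr_pdivlMr// mul1r subr_gt0.
have dev_le (B : {set X}) :
    \sum_(i in B) mu i - \sum_(i in B) pi i <=
    \sum_(i in D) nu i - \sum_(i in D) pi i.
  apply: (@le_trans _ _ (\sum_(i in D) mu i - \sum_(i in D) pi i)); last first.
    by rewrite lerD2r mu_nu//; exact: level_down_set.
  rewrite -!sumrB big_mkcond [leRHS]big_mkcond ler_sum// => i _.
  rewrite mem_D; have [dev_gt0|dev_le0] := ltP 0 (mu i - pi i); case: ifP => // _.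
  exact: ltW.
rewrite ler_norml dev_le andbT lerNl opprB.
apply: le_trans _ (dev_le (~: A)%SET); rewrite le_eqVlt; apply/orP; left.
move: mass_pi; rewrite (sum_setC A mu) (sum_setC A pi) => e; apply/eqP; lra.
Qed.

(** If mu / pi dropped below c at i, the up-set U of points of density at most
    that at i would have mu(U) < c pi(U) <= nu(U), although nu gives up-sets
    at most the mass mu gives them. *)
Lemma ratio_lower_bound c : (forall i, c <= nu i / pi i) ->
  forall i, c <= mu i / pi i.
Proof.
move=> c_nu i; rewrite leNgt; apply/negP => lt_c.
pose r := mu i / pi i; pose D := [set j | r < mu j / pi j]%SET;
pose U := (~: D)%SET.
have pi_U : 0 < \sum_(j in U) pi j.
  rewrite (bigD1 i) ?inE ?ltxx//= ltr_pwDl//.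
  by rewrite sumr_ge0// => j _; exact: ltW.
have nu_mu_U : \sum_(j in U) nu j <= \sum_(j in U) mu j.
  have := mu_nu (level_down_set (c := r) ratio_mono).
  have := mass; rewrite (sum_setC D mu) (sum_setC D nu); lra.
have c_nu_U : c * \sum_(j in U) pi j <= \sum_(j in U) nu j.
  by rewrite mulr_sumr ler_sum// => j _; rewrite -ler_pdivlMr.
have mu_r_U : \sum_(j in U) mu j <= r * \sum_(j in U) pi j.
  rewrite mulr_sumr ler_sum// => j.
  by rewrite !inE -leNgt ler_pdivrMr.
have : r * \sum_(j in U) pi j < c * \sum_(j in U) pi j by rewrite ltr_pM2r.
by lra.
Qed.

End Comparison.

(** * Separation bounds the tail of strong stationary times *)

Section StrongStationaryTimes.
Context {R : realType} {dX : Order.disp_t} {X : finPOrderType dX}.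
Context {d : measure_display} {Omega : measurableType d}.
Variable P : probability Omega R.
Variables (Y : nat -> Omega -> X) (mu : X -> R) (K : X -> X -> R).
Variables (pi : X -> R) (T : Omega -> option nat).
Hypothesis hY : markov_chain P Y mu K.
Hypothesis pi_gt0 : forall i, 0 < pi i.
Hypothesis hpi : stationary pi K.
Local Open Scope classical_set_scope.
Let mY := markov_measurable hY.

Lemma prob_stopping_time_sum t E : measurable E ->
  (forall s, measurable [set w | T w = Some s]) ->
  prob P E = \sum_(s < t.+1) prob P (E `&` [set w | T w = Some (s : nat)]) +
             prob P (E `&` [set w | forall s, (s <= t)%N -> T w <> Some s]).
Proof.
move=> mE mT.
(* The value t.+1 collects all times after t, infinity included. *)
pose f w : 'I_t.+2 := if T w is Some s then inord (minn s t.+1) else ord_max.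
have f_val w : f w = (if T w is Some s then minn s t.+1 else t.+1) :> nat.
  by rewrite /f; case: (T w) => [s|]//=; rewrite inordK// ltnS geq_minr.
have f_stop (s : 'I_t.+1) :
    [set w | f w = widen_ord (leqnSn _) s] = [set w | T w = Some (s : nat)].
  apply/seteqP; split => w /=; have /= st := ltn_ord s.
    move/(congr1 (@nat_of_ord _)); rewrite f_val /=.
    case: (T w) => [u|] /= e; first by congr Some; lia.
    by move: st; rewrite -e ltnn.
  move=> Ts; apply: ord_inj; rewrite f_val Ts /=; lia.
have f_tail : [set w | f w = ord_max] =
    [set w | forall s, (s <= t)%N -> T w <> Some s].
  apply/seteqP; split => w /=.
    move/(congr1 (@nat_of_ord _)); rewrite f_val /= => + s st Ts.
    by rewrite Ts; lia.
  move=> tailw; apply: ord_inj; rewrite f_val /=.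
  case: (T w) tailw => // u tailu; have [ut|] := leqP u t; last by lia.
  by case: (tailu u ut).
have mf a : measurable [set w | f w = a].
  have [at_|ta] := ltnP a t.+1.
    by rewrite (_ : a = widen_ord (leqnSn _) (Ordinal at_)) ?f_stop//; exact/val_inj.
  have -> : a = ord_max by apply/val_inj => /=; have := ltn_ord a; lia.
  rewrite f_tail (_ : [set _ | _] =
      \bigcap_(s in [set s | (s <= t)%N]) ~` [set w | T w = Some s]).
    by apply: bigcap_measurableType => k _; exact: measurableC.
  by apply/seteqP; split => w.
rewrite (prob_fiber_sum P mE mf) big_ord_recr /= f_tail.
by congr (_ + _); apply: eq_bigr => s _; rewrite f_stop.
Qed.

(** A randomized stopping time that has occurred by time n does not disturb
    the next step of the chain: its occurrence is conditionally independent of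
    that step given the history. *)
Lemma prob_stopping_time_step s n x j :
  randomized_stopping_time P Y T -> (s <= n)%N ->
  prob P ([set w | T w = Some s] `&` history Y x n `&` [set w | Y n.+1 w = j]) =
  prob P ([set w | T w = Some s] `&` history Y x n) * K (x n) j.
Proof.
move=> [mT stopT] sn.
(* The history x up to n, prolonged by j, so that one more step is a history. *)
pose y u := if (u <= n)%N then x u else j.
have hist_y m : (m <= n)%N -> history Y y m = history Y x m.
  move=> mn; apply/seteqP; split => w h u um; rewrite h// /y.
    by rewrite (leq_trans um mn).
  by rewrite (leq_trans um mn).
have hist_yS : history Y y n.+1 = history Y x n `&` [set w | Y n.+1 w = j].
  apply/seteqP; split => w.
    move=> h; split; last by rewrite /= h// /y ltnn.
    by move=> u un; rewrite h ?leqW// /y un.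
  move=> [h /= Yj] u; rewrite leq_eqVlt => /predU1P[->|]; first by rewrite Yj /y ltnn.
  by rewrite ltnS => un; rewrite h// /y un.
have markovE : prob P (history Y y n.+1) = prob P (history Y x n) * K (x n) j.
  by case: hY => _ _; rewrite hist_yS.
rewrite -setIA -hist_yS.
have := stopT s n.+1 y (leqW sn); have := stopT s n x sn.
rewrite markovE (hist_y s sn).
have mhist z m := measurable_history (d := d) mY z m.
(* The stopping identities can only be divided by a history of positive mass. *)
have [hist0 _ _|hist_neq0 en eS] := eqVneq (prob P (history Y x s)) 0.
  have prob0 m z : (s <= m)%N -> history Y z s = history Y x s ->
      prob P ([set w | T w = Some s] `&` history Y z m) = 0.
    move=> sm zx; apply/eqP; rewrite eq_le prob_ge0 andbT -hist0 -zx.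
    apply: prob_le => //; first exact: measurableI.
    by move=> w [_ h] u us; rewrite h// (leq_trans us sm).
  by rewrite !prob0 ?mul0r ?leqW// hist_y.
apply: (mulIf hist_neq0); rewrite eS mulrA -en; ring.
Qed.

(** Once stopped the chain is in equilibrium, and stationarity of pi keeps it
    there. *)
Lemma prob_sst_stationary s k i : strong_stationary_time P pi Y T ->
  prob P ([set w | T w = Some s] `&` [set w | Y (s + k)%N w = i]) =
  prob P [set w | T w = Some s] * pi i.
Proof.
move=> [rstT sstT]; elim: k i => [|k IHk] i; first by rewrite addn0.
rewrite addnS (chapman_kolmogorov (K := K) mY).
- under eq_bigr do rewrite IHk -mulrA.
  by rewrite -mulr_sumr hpi.
- exact: rstT.1.
- by move=> x; apply: prob_stopping_time_step => //; rewrite leq_addr.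
Qed.

(** P(Y_t = i) is at least P(T <= t, Y_t = i) = P(T <= t) pi(i). *)
Lemma sep_le_tail t : strong_stationary_time P pi Y T ->
  sep P pi Y t <= tail P T t.
Proof.
move=> sstT; have mT := sstT.1.1.
apply: bigmax_le => [|i _]; first exact: prob_ge0.
rewrite lerBlDl -lerBlDr ler_pdivlMr//.
have := prob_stopping_time_sum t measurableT mT.
rewrite prob_setT setTI -/(tail P T t) => ->; rewrite addrK.
rewrite /law (prob_stopping_time_sum t (mY t i) mT) ler_wpDr ?prob_ge0//.
rewrite mulr_suml ler_sum// => s _; rewrite setTI setIC.
have st : (s <= t)%N by rewrite -ltnS.
by have := prob_sst_stationary s (t - s) i sstT; rewrite (subnKC st) => ->.
Qed.

End StrongStationaryTimes.

(** * Product with an independent uniform variable *)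

Section ProductProbability.
Context {R : realType} {d1 d2 : measure_display}.
Context {O1 : measurableType d1} {O2 : measurableType d2}.
Variables (P1 : probability O1 R) (P2 : probability O2 R).
Local Open Scope classical_set_scope.

Definition product_prob : set (O1 * O2) -> \bar R := (P1 \x P2)%E.

HB.instance Definition _ := Measure.on product_prob.

Let product_prob_setT : product_prob setT = 1%E.
Proof.
rewrite /product_prob -setXTT.
apply: etrans (product_measure1E P1 P2 measurableT measurableT) _.
by rewrite -[RHS]mule1; congr (_ * _)%E; exact: probability_setT.
Qed.

HB.instance Definition _ :=
  Measure_isProbability.Build _ _ _ product_prob product_prob_setT.

Lemma prob_productX A B : measurable A -> measurable B ->
  prob product_prob (A `*` B) = prob P1 A * prob P2 B.
Proof.
move=> mA mB; rewrite {1}/prob /= /product_prob product_measure1E//.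
by rewrite fineM ?fin_num_measure.
Qed.

End ProductProbability.

Lemma prob_uniform_initial {R : realType} (q : R) : 0 <= q <= 1 ->
  prob (uniform_prob (@ltr01 R)) `[0, q]%classic = q.
Proof.
move=> /andP[q0 q1]; rewrite /prob /= /uniform_prob.
rewrite (eq_integral (fun=> 1%:E)); last first.
  move=> x; rewrite inE /= in_itv /= => /andP[x0 xq].
  by rewrite /uniform_pdf x0 (le_trans xq q1) subr0 invr1.
rewrite integral_cst//= lebesgue_measure_itv/= lte_fin mul1e.
case: ltP => [_|q_le0]; first by rewrite oppr0 addr0.
by apply/eqP; rewrite eq_le q0 q_le0.
Qed.

(** * A strong stationary time whose tail at one instant is the separation *)

Section OptimalTime.
Context {R : realType} {dX : Order.disp_t} {X : finPOrderType dX}.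
Context {d : measure_display} {Omega : measurableType d}.
Variable P : probability Omega R.
Variables (Y : nat -> Omega -> X) (mu : X -> R) (K : X -> X -> R).
Variables (pi : X -> R) (t : nat).
Hypothesis hY : markov_chain P Y mu K.
Hypothesis pi_gt0 : forall i, 0 < pi i.
Hypothesis pi1 : \sum_i pi i = 1.
Local Open Scope classical_set_scope.
Let mY := markov_measurable hY.
Local Notation U := (uniform_prob (@ltr01 R)).
Variable Q : probability (Omega * measurableTypeR R)%type R.
Hypothesis Q_rect : forall A B, measurable A -> measurable B ->
  prob Q (A `*` B) = prob P A * prob U B.
Local Notation Omega' := (Omega * measurableTypeR R)%type.

Definition lifted_chain (s : nat) (w : Omega') : X := Y s w.1.

Let fiber_lifted s i :
  [set w | lifted_chain s w = i] = [set w | Y s w = i] `*` setT.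
Proof. by apply/seteqP; split => [w|w []]. Qed.

Let history_lifted x s : history lifted_chain x s = history Y x s `*` setT.
Proof. by apply/seteqP; split => [w|w []]. Qed.

Lemma lifted_markov : markov_chain Q lifted_chain mu K.
Proof.
case: (hY) => _ init mk; split => [s i|i|s x j].
- by rewrite fiber_lifted; exact: measurableX.
- by rewrite fiber_lifted Q_rect// prob_setT mulr1.
have mh := measurable_history mY x s.
rewrite history_lifted fiber_lifted -setXI setIT !Q_rect//.
  by rewrite prob_setT !mulr1.
exact: measurableI.
Qed.

Let sep_ge i : 1 - law P Y t i / pi i <= sep P pi Y t.
Proof. exact: le_bigmax. Qed.

Let sep_le1 : sep P pi Y t <= 1.
Proof.
apply: bigmax_le => // i _.
by rewrite lerBlDr lerDl divr_ge0 ?prob_ge0// ltW.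
Qed.

(** Chosen so that stopping and being at i has probability proportional to
    pi(i), with the largest constant that keeps every acceptance probability
    at most 1. *)
Definition acceptance i : R := (1 - sep P pi Y t) * pi i / law P Y t i.

(** The division is harmless at points of zero mass, whose presence forces the
    separation to be 1. *)
Lemma acceptance_law i : acceptance i * law P Y t i = (1 - sep P pi Y t) * pi i.
Proof.
rewrite /acceptance; have [law0|law_neq0] := eqVneq (law P Y t i) 0.
  have := sep_ge i; rewrite law0 mul0r subr0 => sep_ge1.
  suff -> : sep P pi Y t = 1 by rewrite subrr !mul0r.
  by apply/eqP; rewrite eq_le sep_le1.
by rewrite divfK.
Qed.

Let acceptance_itv i : 0 <= acceptance i <= 1.
Proof.
rewrite /acceptance; apply/andP; split.
  by rewrite divr_ge0 ?prob_ge0// mulr_ge0 ?subr_ge0// ltW.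
have [law0|law_neq0] := eqVneq (law P Y t i) 0; first by rewrite law0 invr0 mulr0.
rewrite ler_pdivrMr ?mul1r ?lt0r ?law_neq0 ?prob_ge0//.
rewrite -ler_pdivlMr//; have := sep_ge i; lra.
Qed.

(** The second component is the uniform variable that randomizes the decision
    to stop; the lower bound on it makes the accepted set an interval. *)
Definition acceptance_time (w : Omega') : option nat :=
  if (0 <= w.2 <= acceptance (Y t w.1)) then Some t else None.

Let stop_fiber i :
  [set w | acceptance_time w = Some t] `&` [set w | lifted_chain t w = i] =
  [set w | Y t w = i] `*` `[0, acceptance i].
Proof.
apply/seteqP; split => -[w u]; rewrite /acceptance_time /lifted_chain /=.
  by move=> [+ Yi]; case: ifP => // accept _; split; rewrite ?in_itv//= -Yi.
by rewrite in_itv /= => -[-> ->].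
Qed.

Let never_stops s : s != t -> [set w | acceptance_time w = Some s] = set0.
Proof.
move=> /eqP st; rewrite -subset0 => w /=; rewrite /acceptance_time.
by case: ifP => // _ [ts]; apply: st.
Qed.

Let measurable_stop s : measurable [set w | acceptance_time w = Some s].
Proof.
have [->|/never_stops ->//] := eqVneq s t.
rewrite (_ : [set _ | _] = \bigcup_(i in [set` [set: X]%SET])
    ([set w | acceptance_time w = Some t] `&` [set w | lifted_chain t w = i])).
  apply: fin_bigcup_measurable => [|i _]; first exact: finite_finset.
  by rewrite stop_fiber; exact: measurableX.
apply/seteqP; split => [w Tt|w [i _ []]//].
by exists (Y t w.1); rewrite //= inE.
Qed.

Let prob_stop_fiber i :
  prob Q ([set w | acceptance_time w = Some t] `&`
          [set w | lifted_chain t w = i]) = (1 - sep P pi Y t) * pi i.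
Proof.
rewrite stop_fiber Q_rect// prob_uniform_initial//.
by rewrite -acceptance_law mulrC.
Qed.

Let prob_stop : prob Q [set w | acceptance_time w = Some t] = 1 - sep P pi Y t.
Proof.
have mL i : measurable [set w | lifted_chain t w = i].
  by rewrite fiber_lifted; exact: measurableX.
have := prob_fiber_sum Q (measurable_stop t) mL => ->.
under eq_bigr do rewrite prob_stop_fiber.
by rewrite -mulr_sumr pi1 mulr1.
Qed.

Lemma acceptance_time_sst : strong_stationary_time Q pi lifted_chain acceptance_time.
Proof.
have stop_history n (x : nat -> X) : (t <= n)%N ->
    prob Q ([set w | acceptance_time w = Some t] `&` history lifted_chain x n) =
    acceptance (x t) * prob Q (history lifted_chain x n).
  move=> tn; have mh := measurable_history mY x n.
  have hist_lifted : history lifted_chain x n `<=`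
      [set w | lifted_chain t w = x t] by move=> w; exact.
  have hist_Y : history Y x n `<=` [set w | Y t w = x t] by move=> w; exact.
  (* The history fixes the state at t, so the event is a rectangle. *)
  rewrite -{1}(setIidl hist_lifted) setICA stop_fiber history_lifted.
  rewrite -setXI setTI (setIidl hist_Y) !Q_rect//.
  by rewrite prob_uniform_initial// prob_setT mulr1 mulrC.
split; first split; first exact: measurable_stop.
- move=> s n x; have [->|/never_stops ->] := eqVneq s t; last first.
    by rewrite !set0I (prob_set0 Q) !mul0r.
  by move=> tn; rewrite (stop_history _ _ tn) (stop_history _ _ (leqnn t)) mulrAC.
move=> s i; have [->|/never_stops ->] := eqVneq s t; last first.
  by rewrite set0I (prob_set0 Q) mul0r.
by rewrite prob_stop_fiber prob_stop.
Qed.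

Lemma tail_acceptance_time : tail Q acceptance_time t = sep P pi Y t.
Proof.
rewrite /tail (_ : [set _ | _] = ~` [set w | acceptance_time w = Some t]).
  by rewrite prob_setC// prob_stop; ring.
apply/seteqP; split => w /=; first by move/(_ t (leqnn t)).
by move=> nt s _; have [->//|/eqP st] := eqVneq s t; rewrite /acceptance_time;
  case: ifP => // _ [ts]; case: st.
Qed.

End OptimalTime.

Theorem corollary3p3 (R : realType) (dX : Order.disp_t) (X : finPOrderType dX)
  (dY : measure_display) (OmegaY : measurableType dY)
  (PY : probability OmegaY R) (Y : nat -> OmegaY -> X)
  (dZ : measure_display) (OmegaZ : measurableType dZ)
  (PZ : probability OmegaZ R) (Z : nat -> OmegaZ -> X)
  (K L : X -> X -> R) (pihat pi : X -> R)
  (hpi : is_pmf pi) (hpi_pos : forall i, 0 < pi i) (hpihat : is_pmf pihat)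
  (hK : is_kernel K) (hL : is_kernel L)
  (hY : markov_chain PY Y pihat K) (hZ : markov_chain PZ Z pihat L)
  (hKpi : stationary pi K) (hLpi : stationary pi L)
  (hratio : nonincreasing (fun i => pihat i / pi i)) :
  [/\ (dominates PY Y PZ Z ->
       stochastically_monotone (time_reversal pi K) ->
       forall t, TV PY pi Y t <= TV PZ pi Z t),
      (dominates PY Y PZ Z ->
       stochastically_monotone (time_reversal pi K) ->
       (forall t, sep PY pi Y t <= sep PZ pi Z t) /\
       (forall (d1 : measure_display) (O1 : measurableType d1)
          (P1 : probability O1 R) (Y1 : nat -> O1 -> X)
          (T1 : O1 -> option nat)
          (d2 : measure_display) (O2 : measurableType d2)
          (P2 : probability O2 R) (Z2 : nat -> O2 -> X)
          (T2 : O2 -> option nat),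
          markov_chain P1 Y1 pihat K -> fastest_sst P1 pihat K pi Y1 T1 ->
          markov_chain P2 Z2 pihat L -> strong_stationary_time P2 pi Z2 T2 ->
          stochastically_smaller P1 T1 P2 T2)) &
      (reversible pi K -> reversible pi L ->
       dominates PY (two_step Y) PZ (two_step Z) ->
       stochastically_monotone (kernel_sq K) ->
       forall t, L2_dist PY pi Y t <= L2_dist PZ pi Z t)].
Proof.
have pi_sum := hpi.2.
have mass t : \sum_i law PY Y t i = \sum_i law PZ Z t i.
  by rewrite (sum_law hY) (sum_law hZ).
have mono t (Kmono : stochastically_monotone (time_reversal pi K)) :=
  law_ratio_nonincreasing hY t hpi_pos Kmono hratio.
have dom_law t (D : {set X}) : dominates PY Y PZ Z -> down_set D ->
    \sum_(i in D) law PY Y t i <= \sum_(i in D) law PZ Z t i.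
  by move=> dom dD; rewrite -(prob_mem_law hY) -(prob_mem_law hZ); exact: dom.
have sep_YZ : dominates PY Y PZ Z ->
    stochastically_monotone (time_reversal pi K) ->
    forall t, sep PY pi Y t <= sep PZ pi Z t.
  move=> dom Kmono t; apply: bigmax_le => [|i _]; first exact: bigmax_ge_id.
  rewrite lerBlDl -lerBlDr.
  apply: (ratio_lower_bound hpi_pos (mass t) (mono t Kmono)) => [D|j].
    exact: dom_law.
  rewrite lerBlDr -lerBlDl; exact: le_bigmax.
split.
- move=> dom Kmono t; apply: bigmax_le => [|A _]; first exact: bigmax_ge_id.
  have [D] := deviation_le hpi_pos (mono t Kmono)
    (fun D => dom_law t D dom) A (etrans (sum_law hY t) (esym pi_sum)).
  rewrite (prob_mem_law hY) => /le_trans; apply.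
  apply: le_trans (ler_norm _) _; rewrite -(prob_mem_law hZ).
  exact: (le_bigmax _ _ D).
- move=> dom Kmono; split; first exact: sep_YZ.
  move=> d1 O1 P1 Y1 T1 d2 O2 P2 Z2 T2 hY1 [_ fast] hZ2 sstT2 t.
  apply: le_trans (sep_le_tail hZ2 hpi_pos hLpi t sstT2).
  rewrite /sep -(law_unique t hZ hZ2) -/(sep PZ pi Z t).
  apply: le_trans (sep_YZ dom Kmono t).
  have rect := @prob_productX _ _ _ _ _ PY (uniform_prob (@ltr01 R)).
  rewrite -(tail_acceptance_time t hY hpi_pos pi_sum rect).
  apply: fast; first exact: (lifted_markov hY rect).
  exact: (acceptance_time_sst t hY hpi_pos pi_sum rect).
- move=> Krev Lrev dom2 _ t.
  rewrite (L2_dist_law hY)// (L2_dist_law hZ)// ler_wsqrtr// lerD2r.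
  apply: stochastic_order_nonincreasing => [D dD|i|//].
    rewrite -(prob_mem_law hY) -(prob_mem_law hZ); exact: dom2.
  by rewrite divr_ge0 ?hpihat.1// ltW.
Qed.
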